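(* Let $A,B\in\mathbb{R}_{\max}^{m\times n}$ have no rows identically equal to $-\infty$ and no common column identically equal to $-\infty$. Then $$\mathrm{spec}(A,B)\subseteq[\underline{D}(A,B),\,\overline{D}(A,B)].$$
   Context: $\mathbb{R}_{\max}=\mathbb{R}\cup\{-\infty\}$. For $A=(a_{ij})\in\mathbb{R}_{\max}^{m\times n}$ and $x\in\mathbb{R}_{\max}^n$, $(Ax)_i=\max_j(a_{ij}+x_j)$. $\mathrm{spec}(A,B)$ is the set of finite $\lambda\in\mathbb{R}$ for which $Ax=\lambda+Bx$ for some $x\in\mathbb{R}_{\max}^n$ with at least one component not equal to $-\infty$. A row is called finite if all its entries are real. For vectors $z,y$ put $z/y=\max\{\gamma\mid\gamma+y\le z\}=\min_{j:\,y_j\neq-\infty}(z_j-y_j)$. With $A_{i\cdot}$ the $i$-th row of $A$, define $\underline{D}(A,B)=\max_{i:\,A_{i\cdot}\text{ finite}}A_{i\cdot}/B_{i\cdot}$ and $\overline{D}(A,B)=-\max_{i:\,B_{i\cdot}\text{ finite}}B_{i\cdot}/A_{i\cdot}$, where a maximum over the empty set is $-\infty$ (so $\underline D=-\infty$ if $A$ has no finite row and $\overline D=+\infty$ if $B$ has no finite row). An interval $[a,b]$ may have infinite endpoints and is empty if $a>b$. *)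

(* Defs.v *)
From HB Require Import structures.
From mathcomp Require Import all_boot all_order all_algebra.
From mathcomp Require Import boolp classical_sets reals ereal.
Set Implicit Arguments.
Unset Strict Implicit.
Unset Printing Implicit Defensive.
Import Order.TTheory GRing.Theory Num.Theory.
Local Open Scope classical_set_scope.
Local Open Scope ring_scope.
Local Open Scope ereal_scope.

(* R_max is represented inside \bar R as the elements different from +oo.     *)
(* With +oo excluded, the library operations adde and maxe are the max-plus   *)
(* product and sum, and -oo is absorbing for adde.                            *)
Definition Rmax_mx (R : realType) (m n : nat) (A : 'M[\bar R]_(m, n)) : Prop :=
  forall i j, A i j != +oo.

Definition maxplus_mul (R : realType) (m n : nat)
    (A : 'M[\bar R]_(m, n)) (x : 'cV[\bar R]_n) : 'cV[\bar R]_m :=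
  \col_i \big[maxe/-oo]_(j < n) (A i j + x j ord0).

Definition spec (R : realType) (m n : nat) (A B : 'M[\bar R]_(m, n)) : set R :=
  [set l : R | exists x : 'cV[\bar R]_n,
    [/\ Rmax_mx x,
        exists j, x j ord0 != -oo &
        maxplus_mul A x = map_mx (adde l%:E) (maxplus_mul B x)]].

Definition finite_row (R : realType) (m n : nat) (A : 'M[\bar R]_(m, n))
    (i : 'I_m) : bool :=
  [forall j, A i j \is a fin_num].

(* z / y in closed form; rdiv_max shows that it is the largest g with         *)
(* g + y <= z. The value is +oo when y is identically -oo.                    *)
Definition rdiv (R : realType) (n : nat) (z y : 'rV[\bar R]_n) : \bar R :=
  \big[mine/+oo]_(j < n | y ord0 j != -oo) (z ord0 j - y ord0 j).

Definition Dlow (R : realType) (m n : nat) (A B : 'M[\bar R]_(m, n)) : \bar R :=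
  \big[maxe/-oo]_(i < m | finite_row A i) rdiv (row i A) (row i B).

Definition Dup (R : realType) (m n : nat) (A B : 'M[\bar R]_(m, n)) : \bar R :=
  - \big[maxe/-oo]_(i < m | finite_row B i) rdiv (row i B) (row i A).

Lemma rdiv_max (R : realType) (n : nat) (z y : 'rV[\bar R]_n) (g : \bar R) :
  Rmax_mx y -> (g <= rdiv z y) <-> (forall j, g + y ord0 j <= z ord0 j).
Proof.
move=> hy; rewrite /rdiv; split=> [h j|h].
  have [->|yj] := eqVneq (y ord0 j) -oo; first by rewrite addeNy leNye.
  have fy : y ord0 j \is a fin_num by rewrite fin_numE yj hy.
  rewrite -leeBrDr //; apply: le_trans h _.
  by rewrite (bigD1 j) //= ge_min lexx.
elim/big_ind: _ => [|a b ha hb|j yj]; first exact: leey.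
  by rewrite le_min ha.
have fy : y ord0 j \is a fin_num by rewrite fin_numE yj hy.
by rewrite leeBrDr.
Qed.

(* Main.v *)
(* If [g] is the residual [A_i / B_i] of a finite row [A_i], then                *)
(* [g + (Bx)_i <= (Ax)_i = l + (Bx)_i]; finiteness of [A_i] makes [(Bx)_i]     *)
(* finite, so it cancels and [g <= l]. The upper bound is the lower bound for   *)
(* the pair [(B, A)], whose spectrum is the opposite of that of [(A, B)].       *)
Require Import Defs.
From mathcomp Require Import all_boot all_order all_algebra.
From mathcomp Require Import boolp classical_sets reals ereal.
Import Order.TTheory GRing.Theory Num.Theory.
Local Open Scope classical_set_scope.
Local Open Scope ring_scope.
Local Open Scope ereal_scope.

(** Entrywise domination [g + B i j <= A i j] survives max-plus combination with any [x]
    ([rdiv_maxplus_mul]). For an eigenvector [x], each finite row of [A] thus bounds [l] from below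
    ([Dlow_le_spec]); [spec_opp] transfers this to the upper bound. *)

Lemma maxplus_mul_neqy (R : realType) (m n : nat) (A : 'M[\bar R]_(m, n))
    (x : 'cV[\bar R]_n) (i : 'I_m) :
  Rmax_mx A -> Rmax_mx x -> maxplus_mul A x i ord0 != +oo.
Proof.
move=> hA hx; rewrite mxE; elim/big_ind: _ => // [a b ha hb|j _].
  by rewrite maxEle; case: ifP.
by rewrite -ltey lte_add_pinfty // ltey.
Qed.

Lemma le_maxplus_mul (R : realType) (m n : nat) (A : 'M[\bar R]_(m, n))
    (x : 'cV[\bar R]_n) (i : 'I_m) (j : 'I_n) :
  A i j + x j ord0 <= maxplus_mul A x i ord0.
Proof. by rewrite mxE (bigD1 j) //= le_max lexx. Qed.

Lemma rdiv_maxplus_mul (R : realType) (m n : nat) (A B : 'M[\bar R]_(m, n))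
    (x : 'cV[\bar R]_n) (i : 'I_m) :
  Rmax_mx B ->
  rdiv (row i A) (row i B) + maxplus_mul B x i ord0 <= maxplus_mul A x i ord0.
Proof.
move=> hB; set g := rdiv _ _.
have hBi : Rmax_mx (row i B) by move=> k j; rewrite mxE; exact: hB.
have hg j : g + B i j <= A i j.
  by have /(rdiv_max _ _ hBi)/(_ j) := lexx g; rewrite !mxE.
rewrite [X in _ + X]mxE; elim/big_ind: _ => [|a b ha hb|j _].
(* [-oo] absorbs even [+oo], so an infinite residual [g] does no harm. *)
- by rewrite addeNy leNye.
- by rewrite maxEle; case: ifP.
- by rewrite addeA; apply: (le_trans _ (le_maxplus_mul _ _ _ A x i j)); exact: leeD2r.
Qed.

Lemma Dlow_le_spec (R : realType) (m n : nat) (A B : 'M[\bar R]_(m, n)) (l : R) :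
  Rmax_mx B -> spec A B l -> Dlow A B <= l%:E.
Proof.
move=> hB [x [hx [j xj] AxE]]; rewrite /Dlow.
elim/big_ind: _ => [|a b ha hb|i /forallP fAi]; first exact: leNye.
  by rewrite ge_max ha.
have AxiE : maxplus_mul A x i ord0 = l%:E + maxplus_mul B x i ord0.
  by rewrite AxE [LHS]mxE.
have Bxi : maxplus_mul B x i ord0 \is a fin_num.
  (* If [(Bx)_i = -oo], then [A i j + x_j <= (Ax)_i = -oo], although [A i j] and [x_j] both differ
     from [-oo]. *)
  rewrite fin_numE maxplus_mul_neqy // andbT; apply: contraTneq (le_maxplus_mul _ _ _ A x i j).
  move=> BxiE; rewrite AxiE BxiE addeNy leeNy_eq adde_eq_ninfty negb_or xj andbT.
  by have := fAi j; rewrite fin_numE => /andP[].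
by rewrite -(leeD2rE _ _ Bxi) -AxiE; exact: rdiv_maxplus_mul.
Qed.

(** The same [x] serves both pairs: add [- l] to both sides of [Ax = l + Bx]. *)
Lemma spec_opp (R : realType) (m n : nat) (A B : 'M[\bar R]_(m, n)) (l : R) :
  spec A B l -> spec B A (- l)%R.
Proof.
move=> [x [hx xj AxE]]; exists x; split=> //; rewrite AxE; apply/matrixP => i k.
by rewrite !mxE -[RHS]/(_ + (_ + _)) addeA -EFinD addNr add0e.
Qed.

Theorem corollary3 (R : realType) (m n : nat) (A B : 'M[\bar R]_(m, n))
    (hA : Rmax_mx A) (hB : Rmax_mx B)
    (hrowA : forall i, ~ (forall j, A i j = -oo))
    (hrowB : forall i, ~ (forall j, B i j = -oo))
    (hcol : forall j, ~ ((forall i, A i j = -oo) /\ (forall i, B i j = -oo))) :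
  spec A B `<=` [set l : R | l%:E \in `[Dlow A B, Dup A B]].
Proof.
move=> l hl /=; rewrite in_itv /= Dlow_le_spec //=.
(* [Dup A B] is [- Dlow B A], so the goal becomes [Dlow B A <= - l]. *)
by rewrite /Dup leeNr -EFinN; apply: Dlow_le_spec => //; exact: spec_opp.
Qed.
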